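(* For all integers $n\ge 1$ and $k\ge 1$, $\chi_{la}\big((2k)P_2\vee O_{2n+1}\big)=3$.
   Context: For a graph $G$ with $q$ edges, a local antimagic labeling is a bijection $f:E(G)\to\{1,\dots,q\}$ such that, writing $f^+(u)=\sum_{e\ni u}f(e)$, we have $f^+(u)\ne f^+(v)$ for every edge $uv$. $\chi_{la}(G)$ is the minimum over all local antimagic labelings of the number of distinct values of $f^+$. $aP_2$ is the disjoint union of $a$ one-edge paths, $O_m$ is the edgeless graph on $m$ vertices, $\vee$ denotes the join. *)

(* Defs.v *)
From mathcomp Require Import all_boot.

Set Implicit Arguments.
Unset Strict Implicit.
Unset Printing Implicit Defensive.

Record sgraph := SGraph {
  vertex :> finType;
  adj : rel vertex;
  adj_sym : symmetric adj;
  adj_irr : irreflexive adj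
}.

Section LocalAntimagic.

Variable G : sgraph.

Definition edges : {set {set G}} :=
  [set [set p.1; p.2] | p : G * G & adj p.1 p.2].

(* A labeling is a total function on {set G}, but only its values on [edges]
   are ever used. *)
Implicit Type f : {set G} -> nat.

Definition vsum f (u : G) : nat := \sum_(d in edges | u \in d) f d.

(* f restricts to a bijection from the edges onto {1, ..., q}. *)
Definition edge_bijection f : Prop :=
  [/\ {in edges, forall d, 1 <= f d <= #|edges|},
      {in edges &, injective f}
    & forall i, 1 <= i <= #|edges| -> exists2 d, d \in edges & f d = i].

Definition local_antimagic f : Prop :=
  edge_bijection f /\ forall u v : G, adj u v -> vsum f u <> vsum f v.

Definition num_colors f : nat := size (undup [seq vsum f u | u : G]).

(* "chi_la(G) = c", as a relation: a graph such as P_2 has no local antimagic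
   labeling, so the minimum need not exist. *)
Definition chi_la_eq (c : nat) : Prop :=
  (exists2 f, local_antimagic f & num_colors f = c) /\
  (forall f, local_antimagic f -> c <= num_colors f).

End LocalAntimagic.

Definition path_adj m : rel 'I_m := fun i j => (i.+1 == j) || (j.+1 == i).

Lemma path_adj_sym m : symmetric (@path_adj m).
Proof. by move=> i j; rewrite /path_adj orbC. Qed.

Lemma path_adj_irr m : irreflexive (@path_adj m).
Proof. by move=> i; rewrite /path_adj orbb eqn_leq ltnn. Qed.

Definition path_graph m : sgraph :=
  SGraph (@path_adj_sym m) (@path_adj_irr m).

Definition edgeless_adj m : rel 'I_m := fun _ _ => false.

Lemma edgeless_adj_sym m : symmetric (@edgeless_adj m).
Proof. by []. Qed.

Lemma edgeless_adj_irr m : irreflexive (@edgeless_adj m).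
Proof. by []. Qed.

Definition edgeless m : sgraph :=
  SGraph (@edgeless_adj_sym m) (@edgeless_adj_irr m).

Definition copies_adj a (G : sgraph) : rel ('I_a * G) :=
  fun x y => (x.1 == y.1) && adj x.2 y.2.

Lemma copies_adj_sym a G : symmetric (@copies_adj a G).
Proof. by move=> x y; rewrite /copies_adj eq_sym adj_sym. Qed.

Lemma copies_adj_irr a G : irreflexive (@copies_adj a G).
Proof. by move=> x; rewrite /copies_adj adj_irr andbF. Qed.

Definition copies a G : sgraph :=
  SGraph (@copies_adj_sym a G) (@copies_adj_irr a G).

Definition join_adj (G H : sgraph) : rel (G + H) := fun x y =>
  match x, y with
  | inl u, inl v => adj u v
  | inr u, inr v => adj u v
  | _, _ => true
  end.

Lemma join_adj_sym G H : symmetric (@join_adj G H).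
Proof. by move=> [x|x] [y|y] //=; rewrite adj_sym. Qed.

Lemma join_adj_irr G H : irreflexive (@join_adj G H).
Proof. by move=> [x|x] /=; rewrite adj_irr. Qed.

Definition join G H : sgraph :=
  SGraph (@join_adj_sym G H) (@join_adj_irr G H).

(* Main.v *)
Require Import Defs.
From mathcomp Require Import all_boot.
From mathcomp Require Import zify.

(** Write the labels as a matrix with [a] rows (one per copy of [P_2]) and
    [2m+1] columns, [m = 2n+1], where column [c] holds the block
    [a c + 1, ..., a c + a], increasing or decreasing according to the parity
    of [c].  Column [m] labels the edges of the copies of [P_2]; the columns [j]
    and [2m - j] label the edges at the vertex [j] of [O_m].  Two consecutive
    entries of a row have a sum independent of the row, so the two ends of the
    copies of [P_2], which see the [2n+2] columns [0..m] and [m..2m], have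
    constant sums [A < B]; the vertices of [O_m] have a constant sum [C]
    because the column indices [j] and [2m - j] have a constant sum.  If [C]
    were [A] or [B], then [a] would divide [n+1], and both equations are
    then impossible by size.  Three colors are needed because of triangles. *)

(** * Edge labelings obtained from functions on pairs of vertices *)

Section EdgeLabels.

Variables (G : sgraph) (lab : G -> G -> nat).

Lemma eq_set2 (T : finType) (x y x' y' : T) :
  [set x; y] = [set x'; y'] -> x = x' /\ y = y' \/ x = y' /\ y = x'.
Proof.
move=> E; have := set22 x y; have := set21 x y; rewrite E.
have := set22 x' y'; have := set21 x' y'; rewrite -{1 2}E.
by do 4! [case/set2P=> ?]; subst; auto.
Qed.

Lemma edgesP (d : {set G}) :
  reflect (exists u v : G, adj u v /\ d = [set u; v]) (d \in edges G).
Proof.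
apply: (iffP imsetP) => [[[u v]]|[u [v [uv ->]]]].
  by rewrite inE => uv ->; exists u, v.
by exists (u, v); rewrite ?inE.
Qed.

Lemma mem_edges (u v : G) : adj u v -> [set u; v] \in edges G.
Proof. by move=> uv; apply/edgesP; exists u, v. Qed.

Lemma adj_neq (u v : G) : adj u v -> u != v.
Proof. by apply: contraTneq => ->; rewrite adj_irr. Qed.

Lemma vsum_adj f (u : G) : vsum f u = \sum_(v | adj u v) f [set u; v].
Proof.
rewrite /vsum -(big_imset f (h := fun v => [set u; v]) (A := adj u)) /=.
  apply: eq_bigl => d; apply/andP/imsetP => [[/edgesP[x [y [xy ->]]]]|].
    rewrite !inE => /orP[] /eqP->; first by exists y.
    exists x; last by rewrite setUC.
    by rewrite [_ \in _]adj_sym.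
  by case=> v uv ->; rewrite mem_edges // !inE eqxx.
by move=> v w _ _ /eq_set2[][] // -> ->.
Qed.

(** An edge has no orientation, so one is picked to evaluate [lab]; the choice is harmless once
    [lab] is symmetric on adjacent pairs. The default 0 is returned only off the edges. *)
Definition edge_label (d : {set G}) : nat :=
  if [pick p : G * G | adj p.1 p.2 && (d == [set p.1; p.2])] is Some p
  then lab p.1 p.2 else 0.

Hypothesis lab_sym : forall u v, adj u v -> lab u v = lab v u.

Lemma edge_labelE (u v : G) : adj u v -> edge_label [set u; v] = lab u v.
Proof.
move=> uv; rewrite /edge_label; case: pickP => [[x y] /= /andP[xy /eqP]|].
  by case/eq_set2=> -[-> ->] //; rewrite lab_sym // adj_sym.
by move/(_ (u, v)); rewrite /= uv eqxx.
Qed.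

(** This avoids counting edges: their labels list [1..q] without repetition, which forces
    [q = #|edges G|]. *)
Lemma edge_label_bijection q :
  (forall u v, adj u v -> 1 <= lab u v <= q) ->
  (forall u v x y, adj u v -> adj x y -> lab u v = lab x y ->
     [set u; v] = [set x; y]) ->
  (forall l, 1 <= l <= q -> exists u v, adj u v /\ lab u v = l) ->
  @edge_bijection G edge_label.
Proof.
move=> lab_bnd lab_inj lab_surj.
have f_inj : {in edges G &, injective edge_label}.
  move=> _ _ /edgesP[u [v [uv ->]]] /edgesP[x [y [xy ->]]].
  by rewrite !edge_labelE //; apply: lab_inj.
have f_bnd : {in edges G, forall d, 1 <= edge_label d <= q}.
  by move=> _ /edgesP[u [v [uv ->]]]; rewrite edge_labelE ?lab_bnd.
have f_surj l : 1 <= l <= q -> exists2 d, d \in edges G & edge_label d = l.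
  case/lab_surj=> u [v [uv <-]]; exists [set u; v]; first exact: mem_edges.
  exact: edge_labelE.
rewrite /edge_bijection; suff -> : #|edges G| = q by [].
have /perm_size : perm_eq [seq edge_label d | d <- enum (edges G)] (iota 1 q).
  apply: uniq_perm; rewrite ?iota_uniq //.
    rewrite map_inj_in_uniq ?enum_uniq // => d e.
    by rewrite !mem_enum; apply: f_inj.
  move=> l; rewrite mem_iota add1n ltnS.
  apply/mapP/idP => [[d]|/f_surj[d dE <-]].
    by rewrite mem_enum => /f_bnd ? ->.
  by exists d; rewrite ?mem_enum.
by rewrite size_map size_iota -cardE.
Qed.

End EdgeLabels.

Lemma triangle_num_colors (G : sgraph) (u v w : G) f :
  adj u v -> adj v w -> adj u w -> @local_antimagic G f -> 3 <= @num_colors G f.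
Proof.
move=> uv vw uw [_ f_la].
have := uniq_leq_size (s1 := [:: vsum f u; vsum f v; vsum f w]).
apply => [|x]; first rewrite /= !inE.
  move/f_la/eqP: uv => /negPf->; move/f_la/eqP: vw => /negPf->.
  by move/f_la/eqP: uw => /negPf->.
by rewrite mem_undup !inE => /or3P[] /eqP->; apply/map_f/mem_enum.
Qed.

(** * The label matrix and its row and column sums *)

Section Entries.

Variable a : nat.

Definition entry c i := a * c + (if odd c then i else a - i.+1) + 1.

Lemma entry_inj c i c' i' :
  i < a -> i' < a -> entry c i = entry c' i' -> c = c' /\ i = i'.
Proof.
move=> ia ia'; rewrite /entry => E.
have cc : c = c' by case: (odd c) E; case: (odd c'); nia.
by split=> //; move: E; rewrite cc; case: (odd c'); lia.
Qed.

Lemma entry_bound c i b : i < a -> c < b -> 1 <= entry c i <= a * b.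
Proof. by move=> ia cb; rewrite /entry; case: (odd c); nia. Qed.

Lemma entry_surj b l : 1 <= l <= a * b ->
  exists c i, [/\ c < b, i < a & entry c i = l].
Proof.
case: l => // l /= lab; have a0 : 0 < a by case: (a) lab.
have r_lt := ltn_pmod l a0; have l_eq := divn_eq l a.
exists (l %/ a), (if odd (l %/ a) then l %% a else a - (l %% a).+1).
split; first by rewrite ltn_divLR // mulnC.
  by case: (odd _); lia.
by rewrite /entry; case: (odd _); lia.
Qed.

Lemma sum_entry_row s p i : i < a ->
  \sum_(j < 2 * p) entry (s + j) i = p * (2 * a * (s + p) + 1).
Proof.
move=> ia; elim: p => [|p IH]; first by rewrite muln0 big_ord0.
rewrite (_ : 2 * p.+1 = (2 * p).+2); last by lia.
rewrite !big_ord_recr /= {}IH /entry (addnS s) /=.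
(* Putting [a = i.+1 + x] removes the truncated subtraction; of the two new columns, one contributes
   the offset [i] and the other [x]. *)
by have /subnKC := ia; move: (a - i.+1) => x <-; case: (odd _) => /=; lia.
Qed.

(** Increasing or decreasing, a column runs through the same block. *)
Lemma sum_entry_col c :
  \sum_(i < a) entry c i = a * (a * c) + \sum_(i < a) i.+1.
Proof.
rewrite (eq_bigr _ (fun i _ => esym (addnA (a * c) _ 1))) big_split /=.
rewrite sum_nat_const card_ord; congr (_ + _).
case: (odd c); first by apply: eq_bigr => i _; rewrite addn1.
rewrite [RHS](reindex_inj rev_ord_inj) /=.
by apply: eq_bigr => i _; rewrite addn1.
Qed.

Lemma double_sum_succ : 2 * \sum_(i < a) i.+1 = a * a.+1.
Proof.
elim: (a) => [|b IH]; first by rewrite big_ord0.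
by rewrite big_ord_recr /= mulnDr IH; lia.
Qed.

End Entries.

(** * The labeling of the join and its vertex sums *)

Section Copies.

Variables a n : nat.
Hypothesis a_gt0 : 0 < a.

Let m := 2 * n + 1.
Let G := join (copies a (path_graph 2)) (edgeless m).

Definition column (b : 'I_2) (j : 'I_m) : nat :=
  if b == ord0 then val j else 2 * m - j.

Definition lab (x y : G) : nat :=
  match x, y with
  | inl u, inl v => entry a m u.1
  | inl u, inr j => entry a (column u.2 j) u.1
  | inr j, inl u => entry a (column u.2 j) u.1
  | inr _, inr _ => 0
  end.

Lemma path_adj2 (b b' : 'I_2) : path_adj b b' = (b != b').
Proof. by case: b b' => [[|[|b]] ?] [[|[|b']] ?]. Qed.

Lemma adj_ll (u v : 'I_a * 'I_2) :
  adj (inl u : G) (inl v) = (u.1 == v.1) && (u.2 != v.2).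
Proof. by rewrite /= /copies_adj /= path_adj2. Qed.

Lemma lab_symm (x y : G) : adj x y -> lab x y = lab y x.
Proof. by case: x y => [u|j] [v|j'] //; rewrite adj_ll => /andP[/eqP/= ->]. Qed.

(* The edge labelled by row [i], column [c], as a set defined by membership so
   that it needs no orientation. *)
Definition cell c i : {set G} := [set z : G | match z with
  | inl u => (u.1 == i :> nat) && (if u.2 == ord0 then c <= m else m <= c)
  | inr j => (c == j) || (c == 2 * m - j)
  end].

Lemma ord2P (b : 'I_2) : b = ord0 \/ b = ord_max.
Proof. by case: b => [[|[|b]] ?]; [left|right|]; try exact: val_inj. Qed.

Lemma lab_cell_lr (u : 'I_a * 'I_2) (j : 'I_m) : exists c (i : 'I_a),
  [/\ c < 2 * m + 1, entry a (column u.2 j) u.1 = entry a c i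
    & [set inl u; inr j] = cell c i].
Proof.
case: u j => [i b] [j jm]; exists (column b (Ordinal jm)), i.
rewrite /column /=.
split=> //; first by case: ifP => _; lia.
apply/setP=> -[[i' b']|[j' jm']]; rewrite !inE.
  rewrite orbF (inj_eq inl_inj) xpair_eqE; congr (_ && _).
  by case: (ord2P b) => ->; case: (ord2P b') => ->; rewrite -!val_eqE /=; lia.
rewrite orFb [LHS](_ : _ = (j' == j)) //=.
by case: ifP => _; lia.
Qed.

(** This gives injectivity: by [entry_inj] the label determines [c] and [i], and these determine the
    edge. *)
Lemma lab_cell (x y : G) : adj x y -> exists c (i : 'I_a),
  [/\ c < 2 * m + 1, lab x y = entry a c i & [set x; y] = cell c i].
Proof.
case: x y => [[i b]|j] [v|j'] // => [|_|_]; last first.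
- by rewrite setUC; apply: lab_cell_lr.
- exact: lab_cell_lr.
rewrite adj_ll; case: v => i' b' /= /andP[/eqP<- bb']; exists m, i; split=> //.
  by lia.
apply/setP=> -[[i'' b'']|[j jm]]; rewrite !inE.
  rewrite !(inj_eq inl_inj) !xpair_eqE leqnn if_same andbT -andb_orr.
  rewrite [X in _ && X](_ : _ = true) ?andbT //.
  by case: (ord2P b) (ord2P b') (ord2P b'') bb' => -> [] -> [] ->.
by rewrite [LHS](_ : _ = false) //=; lia.
Qed.

Lemma lab_surj l : 1 <= l <= a * (2 * m + 1) ->
  exists x y : G, adj x y /\ lab x y = l.
Proof.
case/entry_surj=> c [i [cb ia <-]]; set r := Ordinal ia.
case: (ltngtP c m) => [cm|cm|->].
- by exists (inl (r, ord0)), (inr (Ordinal cm)).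
- have jm : 2 * m - c < m by lia.
  exists (inl (r, ord_max)), (inr (Ordinal jm)); split=> //=.
  by rewrite /column /= subKn //; lia.
- by exists (inl (r, ord0)), (inl (r, ord_max)); rewrite adj_ll eqxx.
Qed.

Let f := edge_label G lab.

Lemma f_bijection : @edge_bijection G f.
Proof.
apply: (@edge_label_bijection G lab lab_symm (a * (2 * m + 1))).
- by move=> x y /lab_cell[c [i [cb -> _]]]; apply: entry_bound.
- move=> x y x' y' /lab_cell[c [i [_ -> ->]]] /lab_cell[c' [i' [_ -> ->]]].
  by case/entry_inj=> // -> ->.
- exact: lab_surj.
Qed.

Lemma vsum_lab (x : G) : vsum f x = \sum_(y | adj x y) lab x y.
Proof.
rewrite vsum_adj; apply: eq_bigr => y xy.
by rewrite /f edge_labelE //; apply: lab_symm.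
Qed.

Lemma vsum_l (u : 'I_a * 'I_2) : @vsum G f (inl u) =
  n.+1 * (2 * a * ((if u.2 == ord0 then 0 else m) + n.+1) + 1).
Proof.
rewrite vsum_lab big_sumType /=.
case: u => i b.
rewrite [X in X + _](_ : _ = entry a m i); last first.
  rewrite (big_pred1 (i, if b == ord0 then ord_max else ord0)) // => -[i' b'].
  rewrite /copies_adj /= path_adj2 /= xpair_eqE eq_sym; congr (_ && _).
  by case: (ord2P b) (ord2P b') => -> [] ->.
rewrite -(@sum_entry_row a _ n.+1 i) // (_ : 2 * n.+1 = m.+1); last by lia.
rewrite /column /=; case: ifP => _.
  by rewrite big_ord_recr /= addnC.
rewrite big_ord_recl addn0; congr (_ + _).
(* The columns [2 * m - j] come in decreasing order, hence the reversal. *)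
rewrite (reindex_inj rev_ord_inj) /=; apply: eq_bigr => j _.
by congr entry; rewrite /bump /=; have := ltn_ord j; lia.
Qed.

Lemma vsum_r (j : 'I_m) : @vsum G f (inr j) = a * ((2 * m + 1) * a + 1).
Proof.
rewrite vsum_lab big_sumType /= [X in _ + X]big_pred0 // addn0.
rewrite -(pair_big predT predT
  (fun (i : 'I_a) (b : 'I_2) => entry a (column b j) i)) /=.
under eq_bigr => i _ do rewrite !big_ord_recl big_ord0 /column /= addn0.
rewrite big_split /= !sum_entry_col.
have := double_sum_succ a; have := ltn_ord j.
by nia.
Qed.

Lemma vsum_lr u j : @vsum G f (inl u) <> vsum f (inr j).
Proof.
rewrite vsum_l vsum_r => E.
(* Modulo [a], everything in [E] vanishes except the term [n.+1]. *)
have /dvdnP[t Et] : a %| n.+1.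
  have := dvdn_mulr ((2 * m + 1) * a + 1) (dvdnn a).
  rewrite -E mulnDr muln1 dvdn_addr //.
  by apply/dvdn_mull/dvdn_mulr/dvdn_mull.
have t_gt0 : 0 < t by case: (t) Et.
set x := t * a in Et; have Em : m = 2 * x - 1 by lia.
have cancel y : n.+1 * y = a * ((2 * m + 1) * a + 1) ->
    t * y = (4 * x - 1) * a + 1.
  move=> {}E; apply/eqP; rewrite -(eqn_pmul2l a_gt0) mulnA (mulnC a) -/x -Et E.
  by rewrite Em; apply/eqP; congr (_ * (_ * _ + _)); nia.
have a_le_x : a <= x by rewrite leq_pmull.
move/cancel: E; rewrite {cancel} Et Em; case: ifP => _.
  (* Smaller sum: [t = 1] gives [x = a] and then [2 * a = 1]; otherwise [2 * a <= x] makes the right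
     side at most [2 * x * x - a + 1], below [2 * x * x + t]. *)
  have [->|t_gt1] : t = 1 \/ 1 < t by lia.
    by rewrite /x; nia.
  have : 2 * a <= x by rewrite leq_mul2r t_gt1 orbT.
  have -> : t * (2 * a * (0 + x) + 1) = 2 * x * x + t by rewrite /x; lia.
  move=> /(leq_mul (leqnn (2 * x))); case: (x) => [|y]; first by lia.
  have -> : 4 * y.+1 - 1 = 4 * y + 3 by lia.
  by lia.
(* Larger sum: by [a <= x] the right side is at most [(4 * x - 1) * x + 1], which is too small. *)
have -> : t * (2 * a * (2 * x - 1 + x) + 1) = 2 * x * (3 * x - 1) + t.
  by rewrite mulnDr muln1 (_ : 2 * x - 1 + x = 3 * x - 1) /x; lia.
have := leq_mul (leqnn (4 * x - 1)) a_le_x.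
case: (x) a_le_x => [|y] a_le_y; first by lia.
have -> : 4 * y.+1 - 1 = 4 * y + 3 by lia.
have -> : 3 * y.+1 - 1 = 3 * y + 2 by lia.
by lia.
Qed.

Lemma f_local_antimagic : @local_antimagic G f.
Proof.
split; first exact: f_bijection.
move=> [u|j] [v|j'] //; last by move=> _ /esym; apply: vsum_lr.
  rewrite adj_ll => /andP[_]; rewrite !vsum_l.
  by case: (ord2P u.2) (ord2P v.2) => -> [] -> //= _; nia.
by move=> _; apply: vsum_lr.
Qed.

Lemma chi_la_copies : chi_la_eq G 3.
Proof.
have lower g : @local_antimagic G g -> 3 <= @num_colors G g.
  have m_gt0 : 0 < m by lia.
  pose i := Ordinal a_gt0; pose j := Ordinal m_gt0.
  have ii : adj (inl (i, ord0) : G) (inl (i, ord_max)).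
    by rewrite adj_ll eqxx.
  by apply: (triangle_num_colors G _ _ (inr j) g ii).
split=> //; exists f; first exact: f_local_antimagic.
(* By [lower], it is enough to list three values containing all the sums. *)
apply/eqP; rewrite eqn_leq (lower _ f_local_antimagic) andbT.
pose A s := n.+1 * (2 * a * (s + n.+1) + 1).
apply: (@uniq_leq_size _ _ [:: A 0; A m; a * ((2 * m + 1) * a + 1)]).
  exact: undup_uniq.
move=> x; rewrite mem_undup => /mapP[[u|j] _ ->]; rewrite !inE.
  by rewrite vsum_l; case: ifP; rewrite eqxx ?orbT.
by rewrite vsum_r eqxx !orbT.
Qed.

End Copies.

Theorem theorem3p1 (n k : nat) (hn : 1 <= n) (hk : 1 <= k) :
  chi_la_eq (join (copies (2 * k) (path_graph 2)) (edgeless (2 * n + 1))) 3.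
Proof. by apply: chi_la_copies; rewrite muln_gt0. Qed.
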